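(* For every positive integer $k$ there exists $N$ such that the following holds: every circulant graph $X$ of type $k$ having $p>N$ vertices, with $p$ prime, has no quantum symmetry.
   Context: A graph here is finite, with unoriented edges between distinct vertices and no multiple edges; its adjacency matrix $d$ has $d_{ij}=1$ if $i,j$ are joined by an edge and $d_{ij}=0$ otherwise. A graph $X$ on $n$ vertices is circulant if its vertices can be labeled by $\mathbb Z_n$ so that $i\sim j$ implies $i+t\sim j+t$ for all $t\in\mathbb Z_n$; then there is a set $S\subset\mathbb Z_n$ with $i\sim j\iff j-i\in S$. Let $E=\{a\in\mathbb Z_n^*: aS=S\}$ (a subgroup of the unit group $\mathbb Z_n^*$); the order $k=|E|$ is called the type of $X$. A magic unitary in a $C^*$-algebra $A$ is a matrix $u=(u_{ij})\in M_n(A)$ whose entries are projections ($u_{ij}=u_{ij}^2=u_{ij}^*$) such that in each row and each column the entries are pairwise orthogonal and sum to $1$. For a graph $X$ with vertex set $\{1,\dots,n\}$, adjacency matrix $d$ and automorphism group $G$, let $\mathcal A$ be the universal $C^*$-algebra generated by the entries $u_{ij}$ of an $n\times n$ magic unitary $u$ satisfying $du=ud$. The functions $v_{ij}=\chi\{g\in G: g(j)=i\}\in C(G)$ form a magic unitary commuting with $d$, giving a canonical surjective morphism $\mathcal A\to C(G)$, $u_{ij}\mapsto v_{ij}$. The graph $X$ has no quantum symmetry if this morphism is an isomorphism $\mathcal A= C(G)$. *)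

(* Defs.v *)
From HB Require Import structures.
From mathcomp Require Import all_boot all_order all_algebra all_fingroup.
From mathcomp Require Import complex.
From mathcomp Require Import boolp classical_sets functions reals topology.
From mathcomp Require Import normedtype.

Set Implicit Arguments.
Unset Strict Implicit.
Unset Printing Implicit Defensive.

Import Order.TTheory GRing.Theory Num.Theory.
Import numFieldNormedType.Exports.

Local Open Scope complex_scope.
Local Open Scope ring_scope.

(* Hierarchy-Builder rejects a join of the normed modules with the algebras   *)
(* (numDomainType already inherits from both), so the complete norm is part   *)
(* of the mixin.  [normc] is the modulus of a complex number, as an element   *)
(* of R.  Since [algType] requires 1 != 0, C*-algebras are unital and         *)
(* nonzero.                                                                   *)
HB.mixin Record isCStarAlgebra (R : realType) A & GRing.Algebra R[i] A := {
  star : A -> A;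
  starD : forall x y : A, star (x + y) = star x + star y;
  starZ : forall (c : R[i]) (x : A), star (c *: x) = c^*%C *: star x;
  starM : forall x y : A, star (x * y) = star y * star x;
  starK : forall x : A, star (star x) = x;
  cnorm : A -> R;
  cnorm_ge0 : forall x : A, 0 <= cnorm x;
  cnorm0_eq0 : forall x : A, cnorm x = 0 -> x = 0;
  cnormD : forall x y : A, cnorm (x + y) <= cnorm x + cnorm y;
  cnormZ : forall (c : R[i]) (x : A), cnorm (c *: x) = Normc.normc c * cnorm x;
  cnormM : forall x y : A, cnorm (x * y) <= cnorm x * cnorm y;
  cstar_identity : forall x : A, cnorm (star x * x) = cnorm x ^+ 2;
  cnorm_complete : forall a : nat -> A,
    (forall e : R, 0 < e -> exists N : nat, forall m n : nat,
       (N <= m)%N -> (N <= n)%N -> cnorm (a m - a n) < e) ->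
    exists l : A, forall e : R, 0 < e -> exists N : nat, forall n : nat,
       (N <= n)%N -> cnorm (a n - l) < e;
}.

#[short(type="cstarAlgType")]
HB.structure Definition CStarAlgebra (R : realType) :=
  {A of GRing.Algebra R[i] A & isCStarAlgebra R A}.

(* With [lrmorphism] giving C-linear, multiplicative and unital, this is a    *)
(* unital *-homomorphism; continuity is automatic.                            *)
Definition star_morphism (R : realType) (A B : cstarAlgType R)
    (phi : {lrmorphism A -> B}) : Prop :=
  forall x : A, phi (star x) = star (phi x).

(* C(G) for a finite group G: all functions G -> C, with pointwise operations *)
(* and the sup norm.                                                          *)
Definition cfunalg (R : realType) (gT : finGroupType) : Type :=
  {ffun gT -> R[i]}.

Section FunctionAlgebra.
Variables (R : realType) (gT : finGroupType).

Local Notation CG := (cfunalg R gT).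
Implicit Types f g : CG.
Import Normc.

HB.instance Definition _ := GRing.Lmodule.copy CG {ffun gT -> R[i]}.
HB.instance Definition _ := GRing.PzRing.copy CG {ffun gT -> R[i]}.
HB.instance Definition _ := GRing.PzSemiRing_isNonZero.Build CG
  (@ffun1_nonzero gT R[i] 1%g).

Fact cfun_scalerAl (c : R[i]) f g : c *: (f * g) = (c *: f) * g.
Proof. by apply/ffunP => x; rewrite !ffunE; exact: mulrA. Qed.

HB.instance Definition _ :=
  GRing.LSemiModule_isLSemiAlgebra.Build R[i] CG cfun_scalerAl.

Fact cfun_scalerAr (c : R[i]) f g : c *: (f * g) = f * (c *: g).
Proof. by apply/ffunP => x; rewrite !ffunE; exact: mulrCA. Qed.

HB.instance Definition _ :=
  GRing.LSemiAlgebra_isSemiAlgebra.Build R[i] CG cfun_scalerAr.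

Definition cfun_star f : CG := [ffun x => (f x)^*%C].

Definition cfun_norm f : R := \big[Num.max/0]_(x : gT) normc (f x).

Lemma normc_ge0 (z : R[i]) : 0 <= normc z.
Proof. by case: z => a b; exact: sqrtr_ge0. Qed.

Lemma cfun_norm_ub f x : normc (f x) <= cfun_norm f.
Proof. exact: le_bigmax. Qed.

Lemma cfun_norm_le f (M : R) :
  0 <= M -> (forall x, normc (f x) <= M) -> cfun_norm f <= M.
Proof. by move=> M0 fM; apply: bigmax_le. Qed.

Lemma cfun_norm_lt f (M : R) :
  0 < M -> (forall x, normc (f x) < M) -> cfun_norm f < M.
Proof. by move=> M0 fM; apply: bigmax_lt. Qed.

Lemma cfun_norm_ge0 f : 0 <= cfun_norm f.
Proof. exact: le_trans (normc_ge0 _) (cfun_norm_ub f 1%g). Qed.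

Lemma normc_conj (z : R[i]) : normc z^*%C = normc z.
Proof. by case: z => a b /=; rewrite sqrrN. Qed.

Fact cfun_starD f g : cfun_star (f + g) = cfun_star f + cfun_star g.
Proof. by apply/ffunP => x; rewrite !ffunE rmorphD. Qed.

Fact cfun_starZ (c : R[i]) f : cfun_star (c *: f) = c^*%C *: cfun_star f.
Proof. by apply/ffunP => x; rewrite !ffunE /= rmorphM. Qed.

Fact cfun_starM f g : cfun_star (f * g) = cfun_star g * cfun_star f.
Proof. by apply/ffunP => x; rewrite !ffunE rmorphM mulrC. Qed.

Fact cfun_starK f : cfun_star (cfun_star f) = f.
Proof. by apply/ffunP => x; rewrite !ffunE conjcK. Qed.

Fact cfun_norm0_eq0 f : cfun_norm f = 0 -> f = 0.
Proof.
move=> f0; apply/ffunP => x; rewrite ffunE; apply: eq0_normc.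
by apply/le_anti; rewrite normc_ge0 -f0 cfun_norm_ub.
Qed.

Fact cfun_normD f g : cfun_norm (f + g) <= cfun_norm f + cfun_norm g.
Proof.
apply: cfun_norm_le => [|x]; first by rewrite addr_ge0 ?cfun_norm_ge0.
by rewrite ffunE (le_trans (le_normcD _ _))// lerD ?cfun_norm_ub.
Qed.

Fact cfun_normZ (c : R[i]) f : cfun_norm (c *: f) = normc c * cfun_norm f.
Proof.
apply/le_anti/andP; split.
  apply: cfun_norm_le => [|x]; first by rewrite mulr_ge0 ?normc_ge0 ?cfun_norm_ge0.
  by rewrite ffunE normcM ler_wpM2l ?normc_ge0 ?cfun_norm_ub.
have [->|c0] := eqVneq c 0; first by rewrite normc0 mul0r cfun_norm_ge0.
have nc0 : 0 < normc c.
  by rewrite lt_def normc_ge0 andbT; apply: contra c0 => /eqP/eq0_normc ->.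
rewrite -ler_pdivlMl//; apply: cfun_norm_le => [|x].
  by rewrite mulr_ge0 ?invr_ge0 ?normc_ge0 ?cfun_norm_ge0.
by rewrite ler_pdivlMl// -normcM (le_trans _ (cfun_norm_ub _ x))// ffunE.
Qed.

Fact cfun_normM f g : cfun_norm (f * g) <= cfun_norm f * cfun_norm g.
Proof.
apply: cfun_norm_le => [|x]; first by rewrite mulr_ge0 ?cfun_norm_ge0.
by rewrite ffunE normcM ler_pM ?normc_ge0 ?cfun_norm_ub.
Qed.

Fact cfun_cstar_identity f : cfun_norm (cfun_star f * f) = cfun_norm f ^+ 2.
Proof.
have eqn x : normc ((cfun_star f * f) x) = normc (f x) ^+ 2.
  by rewrite !ffunE normcM normc_conj.
apply/le_anti/andP; split.
  apply: cfun_norm_le => [|x]; first by rewrite exprn_ge0 ?cfun_norm_ge0.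
  by rewrite eqn lerXn2r ?nnegrE ?normc_ge0 ?cfun_norm_ge0 ?cfun_norm_ub.
set S := cfun_norm (_ * _); have S0 : 0 <= S by exact: cfun_norm_ge0.
rewrite -(sqr_sqrtr S0) lerXn2r ?nnegrE ?cfun_norm_ge0 ?sqrtr_ge0//.
apply: cfun_norm_le => [|x]; first exact: sqrtr_ge0.
rewrite -(@ler_pXn2r _ 2) ?nnegrE ?normc_ge0 ?sqrtr_ge0// (sqr_sqrtr S0) -eqn.
exact: cfun_norm_ub.
Qed.

Lemma real_cauchy_cvg (a : nat -> R) :
  (forall e : R, 0 < e -> exists N : nat, forall m n : nat,
     (N <= m)%N -> (N <= n)%N -> `|a m - a n| < e) ->
  exists l : R, forall e : R, 0 < e -> exists N : nat, forall n : nat,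
     (N <= n)%N -> `|a n - l| < e.
Proof.
move=> ca; have /cauchy_cvg/cvg_ex[l /cvgrPdist_lt al] : cauchy (a @ \oo)%classic.
  apply/cauchy_exP => e /ca[N aN]; exists (a N); exists N => // n /= Nn.
  exact: aN.
exists l => e /al[N _ aN]; exists N => n Nn; rewrite distrC; exact: aN.
Qed.

Fact cfun_norm_complete (a : nat -> CG) :
  (forall e : R, 0 < e -> exists N : nat, forall m n : nat,
     (N <= m)%N -> (N <= n)%N -> cfun_norm (a m - a n) < e) ->
  exists l : CG, forall e : R, 0 < e -> exists N : nat, forall n : nat,
     (N <= n)%N -> cfun_norm (a n - l) < e.
Proof.
move=> ca.
have caP (h : R[i] -> R) (hP : forall z w, `|h z - h w| <= normc (z - w)) x :
    exists l : R, forall e : R, 0 < e -> exists N : nat, forall n : nat,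
      (N <= n)%N -> `|h (a n x) - l| < e.
  apply: real_cauchy_cvg => e /ca[N aN]; exists N => m n Nm Nn.
  apply: le_lt_trans (aN _ _ Nm Nn); apply: le_trans (hP _ _) _.
  by have := cfun_norm_ub (a m - a n) x; rewrite !ffunE.
have hRe (z w : R[i]) : `|complex.Re z - complex.Re w| <= normc (z - w).
  case: z w => [z1 z2] [w1 w2] /=.
  by rewrite -sqrtr_sqr ler_wsqrtr// lerDl sqr_ge0.
have hIm (z w : R[i]) : `|complex.Im z - complex.Im w| <= normc (z - w).
  case: z w => [z1 z2] [w1 w2] /=.
  by rewrite -sqrtr_sqr ler_wsqrtr// lerDr sqr_ge0.
have /choice[lr lrP] := caP _ hRe; have /choice[li liP] := caP _ hIm.
pose l : CG := [ffun x => lr x +i* li x]; exists l => e e0.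
have e20 : 0 < e / 2 by rewrite divr_gt0.
have NP x : exists N : nat, forall n : nat, (N <= n)%N -> normc ((a n - l) x) < e.
  have [N1 aN1] := lrP x _ e20; have [N2 aN2] := liP x _ e20.
  exists (maxn N1 N2) => n; rewrite geq_max => /andP[/aN1 b1 /aN2 b2].
  rewrite !ffunE; case: (a n x) b1 b2 => [z1 z2] /= b1 b2.
  rewrite (splitr e); apply: le_lt_trans (ltrD b1 b2).
  rewrite -[leRHS]ger0_norm ?addr_ge0 // -sqrtr_sqr ler_wsqrtr//.
  rewrite [leRHS]sqrrD !real_normK ?num_real// -addrA lerD2l lerDr.
  by rewrite mulrn_wge0 ?mulr_ge0.
have /choice[N aN] := NP; exists (\max_x N x)%N => n Nn.
apply: cfun_norm_lt => // x; apply: aN; apply: leq_trans Nn.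
exact: leq_bigmax.
Qed.

HB.instance Definition _ := isCStarAlgebra.Build R CG
  cfun_starD cfun_starZ cfun_starM cfun_starK
  cfun_norm_ge0 cfun_norm0_eq0 cfun_normD cfun_normZ cfun_normM
  cfun_cstar_identity cfun_norm_complete.

End FunctionAlgebra.

Record sgraph (n : nat) := SGraph {
  adj :> rel 'I_n;
  adj_sym : symmetric adj;
  adj_irr : irreflexive adj
}.

Definition adj_mx (A : pzRingType) n (X : sgraph n) : 'M[A]_n :=
  \matrix_(i, j) (X i j)%:R.

Definition is_autom n (X : sgraph n) : pred 'S_n :=
  fun g => [forall i, forall j, X (g i) (g j) == X i j].

Lemma is_automP n (X : sgraph n) (g : 'S_n) :
  reflect (forall i j, X (g i) (g j) = X i j) (is_autom X g).
Proof.
apply: (iffP forallP) => [aut i j|aut i]; first by have /forallP/(_ j)/eqP := aut i.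
by apply/forallP => j; rewrite aut.
Qed.

Definition aut_set n (X : sgraph n) : {set 'S_n} := [set g | is_autom X g].

Fact aut_group_set n (X : sgraph n) : group_set (aut_set X).
Proof.
apply/group_setP; split=> [|g h].
  by rewrite inE; apply/is_automP => i j; rewrite !perm1.
rewrite !inE => /is_automP gX /is_automP hX; apply/is_automP => i j.
by rewrite !permM hX gX.
Qed.

Canonical aut_group n (X : sgraph n) : {group 'S_n} := Group (aut_group_set X).

Definition is_projection (R : realType) (A : cstarAlgType R) (x : A) : Prop :=
  x * x = x /\ star x = x.

Record magic_unitary (R : realType) (A : cstarAlgType R) n (u : 'M[A]_n) :
    Prop := MagicUnitary {
  magic_proj : forall i j, is_projection (u i j);
  magic_row_orth : forall i j k, j != k -> u i j * u i k = 0;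
  magic_col_orth : forall i j k, i != k -> u i j * u k j = 0;
  magic_row_sum : forall i, \sum_j u i j = 1;
  magic_col_sum : forall j, \sum_i u i j = 1
}.

Definition graph_magic (R : realType) (A : cstarAlgType R) n (X : sgraph n)
    (u : 'M[A]_n) : Prop :=
  magic_unitary u /\ adj_mx A X *m u = u *m adj_mx A X.

(* (A, u) is the universal C*-algebra generated by the entries of a magic     *)
(* unitary commuting with d, characterized by its universal property; that    *)
(* the u i j generate A is the uniqueness clause.                             *)
Definition universal_graph_magic (R : realType) n (X : sgraph n)
    (A : cstarAlgType R) (u : 'M[A]_n) : Prop :=
  graph_magic X u /\
  forall (B : cstarAlgType R) (w : 'M[B]_n), graph_magic X w ->
    exists phi : {lrmorphism A -> B},
      [/\ star_morphism phi, forall i j, phi (u i j) = w i j &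
          forall psi : {lrmorphism A -> B}, star_morphism psi ->
            (forall i j, psi (u i j) = w i j) -> psi =1 phi].

Definition autC (R : realType) n (X : sgraph n) : cstarAlgType R :=
  cfunalg R (subg_of (aut_group X)).

Definition autval n (X : sgraph n) (g : subg_of (aut_group X)) : 'S_n := sgval g.

Definition aut_magic (R : realType) n (X : sgraph n) : 'M[autC R X]_n :=
  \matrix_(i, j) ([ffun g => (autval g j == i)%:R] : cfunalg R (subg_of (aut_group X))).

Lemma aut_magicE (R : realType) n (X : sgraph n) i j (g : subg_of (aut_group X)) :
  (aut_magic R X i j : cfunalg R _) g = (autval g j == i)%:R.
Proof. by rewrite mxE ffunE. Qed.

Lemma aut_magic_graph_magic (R : realType) n (X : sgraph n) :
  graph_magic X (aut_magic R X).
Proof.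
have sumE (I : finType) (F : I -> autC R X) g :
    (\sum_i F i : cfunalg R _) g = \sum_i (F i : cfunalg R _) g.
  exact: sum_ffunE.
split; first split.
- move=> i j; split; apply/ffunP => g; rewrite !ffunE !aut_magicE.
    by case: eqP; rewrite ?mulr0 ?mulr1.
  by case: eqP; rewrite ?conjc1 ?conjc0.
- move=> i j k jk; apply/ffunP => g; rewrite !ffunE !aut_magicE.
  case: (eqVneq (autval g j) i) => [<-|_]; last by rewrite mul0r.
  by rewrite (inj_eq perm_inj) eq_sym (negbTE jk) mulr0.
- move=> i j k ik; apply/ffunP => g; rewrite !ffunE !aut_magicE.
  case: (eqVneq (autval g j) i) => [->|_]; last by rewrite mul0r.
  by rewrite (negbTE ik) mulr0.
- move=> i; apply/ffunP => g; rewrite sumE ffunE.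
  rewrite (bigD1 ((autval g)^-1%g i))//= aut_magicE permKV eqxx big1 ?addr0// => j.
  by rewrite aut_magicE (canF_eq (permK _)) => /negbTE->.
- move=> j; apply/ffunP => g; rewrite sumE ffunE.
  rewrite (bigD1 (autval g j))//= aut_magicE eqxx big1 ?addr0// => i.
  by rewrite aut_magicE eq_sym => /negbTE->.
apply/matrixP => i j; apply/ffunP => g; rewrite !mxE !sumE.
have natE (b : bool) : (b%:R : cfunalg R (subg_of (aut_group X))) g = b%:R.
  by case: b; rewrite ffunE.
rewrite (bigD1 (autval g j))//= big1 ?addr0; last first.
  move=> k; rewrite ffunE aut_magicE eq_sym => /negbTE->; exact: mulr0.
rewrite [RHS](bigD1 ((autval g)^-1%g i))//= big1 ?addr0; last first.
  move=> k; rewrite ffunE aut_magicE (canF_eq (permK _)) => /negbTE->; exact: mul0r.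
rewrite !ffunE !aut_magicE permKV !eqxx mulr1 mul1r !mxE !natE.
have /[!inE]/is_automP gX : autval g \in aut_group X by exact: subgP.
by rewrite -[in RHS]gX permKV.
Qed.

(* The first conjunct, always true, only says that the second is not vacuous; *)
(* (A, u) is unique up to isomorphism.                                        *)
Definition no_quantum_symmetry (R : realType) n (X : sgraph n) : Prop :=
  (exists (A : cstarAlgType R) (u : 'M[A]_n), universal_graph_magic X u) /\
  forall (A : cstarAlgType R) (u : 'M[A]_n), universal_graph_magic X u ->
  forall phi : {lrmorphism A -> autC R X}, star_morphism phi ->
    (forall i j, phi (u i j) = aut_magic R X i j) -> bijective phi.

(* [l] labels the vertices by Z_n, the vertex with label a being [l a].  For  *)
(* n <= 1, ['Z_n] is Z_2 rather than Z_n: then there is no such labeling.     *)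
Definition circulant_labeling n (X : sgraph n) (l : 'Z_n -> 'I_n) : Prop :=
  bijective l /\
  forall i j t : 'Z_n, X (l i) (l j) -> X (l (i + t)) (l (j + t)).

Definition circ_set n (X : sgraph n) (l : 'Z_n -> 'I_n) : {set 'Z_n} :=
  [set s | X (l 0) (l s)].

Lemma circ_setP n (X : sgraph n) (l : 'Z_n -> 'I_n) :
  circulant_labeling X l -> forall i j, X (l i) (l j) = (j - i \in circ_set X l).
Proof.
move=> [_ lX] i j; rewrite inE; apply/idP/idP => [/(lX _ _ (- i))|/(lX _ _ i)].
  by rewrite subrr.
by rewrite add0r subrK.
Qed.

Definition circ_units n (X : sgraph n) (l : 'Z_n -> 'I_n) : {set {unit 'Z_n}} :=
  [set a | [set FinRing.uval a * s | s in circ_set X l] == circ_set X l].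

Definition circulant_of_type n (X : sgraph n) (k : nat) : Prop :=
  exists2 l : 'Z_n -> 'I_n, circulant_labeling X l & #|circ_units X l| = k.

(* Main.v *)
Require Import Defs.
From HB Require Import structures.
From mathcomp Require Import all_boot all_order all_algebra all_fingroup.
From mathcomp Require Import ring reals complex.

Set Implicit Arguments.
Unset Strict Implicit.
Unset Printing Implicit Defensive.

Import Order.TTheory GRing.Theory Num.Theory.

Local Open Scope ring_scope.

(* Label the vertices by F_p and fix a nontrivial character chi of F_p with
   values in the p-th roots of unity.  The functions chi (s * _) are
   eigenvectors of the adjacency matrix, and since the p-th cyclotomic
   polynomial is irreducible, for nonzero s and b the eigenvalues agree only if
   b / s lies in the group E of order k.  So the coefficient alpha s b of
   chi (b * _) in the coaction applied to chi (s * _) vanishes unless b is in sE,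
   and the coaction being multiplicative means
     alpha (s + t) c = \sum_b alpha s b * alpha t (c - b).
   If t / s avoids the at most k ^ 4 ratios (e' - e) / (f - f') with e, e', f, f'
   in E, comparing coefficients at c = s * e + t * f gives
   alpha s (s * e) * alpha t (t * f) = 0 for e != f.  When p is large, every
   nonzero t can be written r + (t - r) with r / s and (t - r) / r both generic,
   which extends this orthogonality to all nonzero s and t.  It follows that
   alpha (s + t) ((s + t) * e) = alpha s (s * e) * alpha t (t * e), so that all
   coefficients commute, and hence so do the entries of the magic unitary.  Then
   C(Aut X) has the universal property. *)

(** * Convolution families with small support *)

Section ConvolutionCoefficients.
Variables (F : finFieldType) (A : pzRingType) (E : {set F}) (alpha : F -> F -> A).
Hypothesis alpha_supp : forall s b, s != 0 -> b / s \notin E -> alpha s b = 0.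
Hypothesis alpha_conv :
  forall s t c, alpha (s + t) c = \sum_b alpha s b * alpha t (c - b).
Hypothesis card_large : (#|E| ^ 4 * 2 + 2 < #|F|)%N.

(* For e, f in E with e != f, the number s * e + t * f is neither another
   s * e' + t * f' nor an element of (s + t)E, unless t / s lies in this set. *)
Definition ratios : {set F} :=
  [set (x.1.1 - x.1.2) / (x.2.1 - x.2.2) | x in setX (setX E E) (setX E E)].

Lemma card_ratios : (#|ratios| <= #|E| ^ 4)%N.
Proof.
apply: leq_trans (leq_imset_card _ _) _.
by rewrite !cardsX !expnS expn0 muln1 -mulnA.
Qed.

(** Genericity is used in this form: if [x] and [y] differed, [r] would be one of the [ratios]. *)
Lemma ratios_eq a b x y r : a \in E -> b \in E -> x \in E -> y \in E ->
  r \notin ratios -> a - b = r * (x - y) -> x = y.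
Proof.
move=> aE bE xE yE rQ ab; apply/eqP; apply: contraNT rQ.
rewrite -subr_eq0 => xy0; apply/imsetP; exists ((a, b), (x, y)).
  by rewrite !inE /= aE bE xE.
by rewrite /= ab mulfK.
Qed.

Lemma alpha_generic_orth s t e f : s != 0 -> t != 0 -> t / s \notin ratios ->
  e \in E -> f \in E -> e != f -> alpha s (s * e) * alpha t (t * f) = 0.
Proof.
move=> s0 t0 gen eE fE ef.
(* [t = - s] is not generic, because -1 is the ratio [(f - e) / (e - f)]. *)
have mQ : s + t != 0.
  apply: contraNneq gen => st0; apply/imsetP; exists ((f, e), (e, f)).
    by rewrite !inE /= eE fE.
  have -> : t = - s by apply/eqP; rewrite -addr_eq0 addrC st0.
  by rewrite /= -opprB !mulNr !mulfV // subr_eq0.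
(* The left side vanishes: [s * e + t * f = g * (s + t)] with [g] in [E] gives
   [e - g = t / s * (g - f)], so [g = f] by genericity, and then [e = f]. *)
have := alpha_conv s t (s * e + t * f); rewrite alpha_supp //; last first.
  apply: contraNN ef => gE; set g := _ / _ in gE.
  have Dg : s * e + t * f = g * (s + t) by rewrite divfK.
  have gf : g = f.
    apply: (ratios_eq eE gE gE fE gen); apply: (mulfI s0).
    have -> : s * (t / s * (g - f)) = t * (g - f) by field.
    by rewrite mulrBr -[s * e](addrK (t * f)) Dg; ring.
  by apply/eqP/(mulfI s0)/(addIr (t * f)); rewrite Dg gf; ring.
(* Only [b = s * e] contributes: if both factors are in the support,
   [b / s - e = t / s * (f - c / t)], and genericity forces [c = t * f]. *)
rewrite (bigD1 (s * e)) //= addrAC subrr add0r big1 ?addr0 // => b bse.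
have [e'E|/(alpha_supp s0)->] := boolP (b / s \in E); last by rewrite mul0r.
set c := _ - b; have [f'E|/(alpha_supp t0)->] := boolP (c / t \in E); last exact: mulr0.
case/eqP: bse; rewrite -[b](divfK s0) mulrC; congr (_ * _).
have ff : f = c / t.
  apply: (ratios_eq e'E eE fE f'E gen); apply: (mulfI s0).
  have -> : s * (t / s * (f - c / t)) = t * f - c by field; rewrite t0.
  have -> : s * (b / s - e) = b - s * e by field.
  by rewrite /c; ring.
apply: (mulfI s0); rewrite mulrC divfK //.
have : c = t * f by rewrite ff mulrC divfK.
by rewrite /c => /(canRL (subrK _)); rewrite addrC => /addrI.
Qed.

Lemma exists_generic s t : s != 0 -> t != 0 ->
  exists r, [/\ r != 0, t - r != 0, r / s \notin ratios & (t - r) / r \notin ratios].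
Proof.
move=> s0 t0.
(* [B] has at most [2 + 2 * #|E| ^ 4] elements. Its last family solves [(t - r) / r = q]; at
   [q = -1], where there is no solution, it takes the default value 0. *)
pose B := [set 0; t] :|: [set s * q | q in ratios] :|: [set t / (1 + q) | q in ratios].
have [r rB] : exists r, r \notin B.
  apply/existsP; apply: contraLR card_large; rewrite -leqNgt negb_exists => /forallP Ball.
  have -> : #|F| = #|B| by apply: eq_card => x; have := Ball x; rewrite negbK => ->.
  rewrite addnC muln2 -addnn addnA.
  apply: leq_trans (leq_card_setU _ _) _; apply: leq_add.
    apply: leq_trans (leq_card_setU _ _) _; apply: leq_add; first by rewrite cards2; case: (_ != _).
    exact: leq_trans (leq_imset_card _ _) card_ratios.
  exact: leq_trans (leq_imset_card _ _) card_ratios.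
move: rB; rewrite !inE !negb_or => /andP[/andP[/andP[r0 rt] rs] rq]; exists r.
split=> //; first by rewrite subr_eq0 eq_sym.
  by apply: contra rs => rsQ; apply/imsetP; exists (r / s) => //; rewrite mulrC divfK.
apply: contra rq => rqQ; apply/imsetP; exists ((t - r) / r) => //.
have -> : 1 + (t - r) / r = t / r by field.
by rewrite invf_div mulrC divfK.
Qed.

Lemma alpha_orth s t e f : s != 0 -> t != 0 ->
  e \in E -> f \in E -> e != f -> alpha s (s * e) * alpha t (t * f) = 0.
Proof.
move=> s0 t0 eE fE ef; have [r [r0 tr0 rs trr]] := exists_generic s0 t0.
have {1}-> : t = r + (t - r) by rewrite addrC subrK.
rewrite alpha_conv mulr_sumr big1 // => b _.
have [xE|/(alpha_supp r0)->] := boolP (b / r \in E); last by rewrite mul0r mulr0.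
have [yE|/(alpha_supp tr0)->] := boolP ((t * f - b) / (t - r) \in E); last by rewrite !mulr0.
have Db : b = r * (b / r) by rewrite mulrC divfK.
(* If [b / r] differs from [e], the factors at [s] and [r] are orthogonal. Otherwise those at [r]
   and [t - r] are, since equal quotients would give [t * f = t * e]. *)
have [ex|ex] := eqVneq e (b / r); last by rewrite mulrA Db alpha_generic_orth // mul0r.
have Dc : t * f - b = (t - r) * ((t * f - b) / (t - r)) by rewrite [RHS]mulrC divfK.
rewrite [in X in _ * (X * _)]Db [in X in _ * (_ * X)]Dc alpha_generic_orth ?mulr0 //.
apply: contraNneq ef => xy; apply/eqP/(mulfI t0).
move: Dc; rewrite -xy -ex => /(canRL (subrK _)) ->.
by rewrite Db -ex; ring.
Qed.

(** By orthogonality a term [alpha s (s * x) * alpha t (t * y)] of the convolution needs [x = y],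
    and then [(s + t) * x = (s + t) * e] leaves only [x = e]. *)
Lemma alpha_mul s t e : s != 0 -> t != 0 -> s + t != 0 -> e \in E ->
  alpha (s + t) ((s + t) * e) = alpha s (s * e) * alpha t (t * e).
Proof.
move=> s0 t0 st0 eE; rewrite alpha_conv (bigD1 (s * e)) //= [X in _ + X]big1.
  by rewrite addr0; congr (_ * alpha _ _); ring.
move=> b bse.
have [xE|/(alpha_supp s0)->] := boolP (b / s \in E); last by rewrite mul0r.
set c := _ - b; have [yE|/(alpha_supp t0)->] := boolP (c / t \in E); last exact: mulr0.
have Db : b = s * (b / s) by rewrite mulrC divfK.
have Dc : c = t * (c / t) by rewrite [RHS]mulrC divfK.
rewrite Db Dc alpha_orth //; apply: contraNneq bse => xy.
rewrite Db; apply/eqP; congr (_ * _); apply: (mulfI st0); rewrite -[RHS](subrK b) -/c Dc -xy.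
by field.
Qed.

Lemma alpha_comm s b t c : s != 0 -> t != 0 -> alpha s b * alpha t c = alpha t c * alpha s b.
Proof.
move=> s0 t0.
have [xE|/(alpha_supp s0)->] := boolP (b / s \in E); last by rewrite mul0r mulr0.
have [yE|/(alpha_supp t0)->] := boolP (c / t \in E); last by rewrite mul0r mulr0.
have -> : b = s * (b / s) by rewrite mulrC divfK.
have -> : c = t * (c / t) by rewrite mulrC divfK.
move: (b / s) (c / t) xE yE => e f eE fE.
have [<-|ef] := eqVneq e f; last by rewrite !alpha_orth // eq_sym.
have comm' x y : x != 0 -> y != 0 -> x + y != 0 ->
    alpha x (x * e) * alpha y (y * e) = alpha y (y * e) * alpha x (x * e).
  by move=> x0 y0 xy0; rewrite -!alpha_mul // addrC.
have [st0|st0] := eqVneq (s + t) 0; last exact: comm'.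
(* When [s + t = 0], splitting [t] as [r + (t - r)] gives two factors whose indices are not opposite
   to [s]. *)
have [r [r0 tr0 rs _]] := exists_generic s0 t0.
have rs0 : s + r != 0.
  apply: contraNneq tr0 => sr; have -> : t - r = (s + t) - (s + r) by ring.
  by rewrite st0 sr subrr.
have srt : s + (t - r) != 0 by rewrite addrA st0 add0r oppr_eq0.
have -> : t = r + (t - r) by rewrite addrC subrK.
rewrite alpha_mul // ?[r + _]addrC ?subrK //.
by rewrite mulrA comm' // -mulrA comm' // mulrA.
Qed.

End ConvolutionCoefficients.

(** * Rational relations between roots of unity *)

Lemma nontrivial_unity_root (C : numClosedFieldType) p : prime p ->
  exists2 w : C, w ^+ p = 1 & w != 1.
Proof.
move=> pr; have p0 := prime_gt0 pr.
have [|w /eqP w0] := closed_rootP (\poly_(i < p) (1 : C)) _.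
  by rewrite size_poly_eq ?oner_neq0 // gtn_eqF // prime_gt1.
have {}w0 : \sum_(i < p) w ^+ i = 0.
  by rewrite -[RHS]w0 horner_poly; apply: eq_bigr => i _; rewrite mul1r.
exists w; first by apply/eqP; rewrite -subr_eq0 subrX1 w0 mulr0.
apply: contra_eqN w0 => /eqP->.
under eq_bigr do rewrite expr1n.
by rewrite sumr_const card_ord pnatr_eq0 -lt0n.
Qed.

(* [('X + 1) ^+ p - 1] divided by ['X] *)
Lemma irreducible_binomial_poly p : prime p ->
  irreducible_poly (\poly_(i < p) ('C(p, i.+1)%:R : rat)).
Proof.
move=> pr; have p1 := prime_gt1 pr; have p0 := prime_gt0 pr.
pose q : {poly int} := \poly_(i < p) 'C(p, i.+1)%:Z.
have sq : size q = p by rewrite size_poly_eq // prednK // binn.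
have -> : \poly_(i < p) ('C(p, i.+1)%:R : rat) = map_poly intr q.
  by apply/polyP => i; rewrite coef_map !coef_poly; case: ifP.
apply/irreducible_rat_int/(@eisenstein_crit p) => //.
- by rewrite sq gtn_eqF.
- rewrite lead_coefE sq coef_poly prednK // leqnn binn.
  by rewrite dvdzE /= dvdn1 gtn_eqF.
- rewrite coef_poly p0 bin1 dvdzE; change (~~ (p ^ 2 %| p)%N).
  by apply/negP => /dvdn_leq; rewrite p0 => /(_ isT); rewrite leqNgt -{1}[p]expn1 ltn_exp2l.
- move=> i; rewrite sq => ip; rewrite coef_poly.
  have ip' : (i.+1 < p)%N by rewrite -ltn_predRL.
  by rewrite (ltnW ip') dvdzE prime_dvd_bin.
Qed.

(** Subtracting [c p.-1] times the vanishing sum of all powers of [w] leaves a polynomial [f] of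
    degree below [p.-1] with root [w]. Its shift [g] shares the root [w - 1] with the irreducible
    [q] of degree [p.-1], so [f] is zero. *)
Lemma unity_root_relation (C : numClosedFieldType) p (w : C) (c : nat -> rat) :
  prime p -> w ^+ p = 1 -> w != 1 -> \sum_(i < p) ratr (c i) * w ^+ i = 0 ->
  forall i, (i < p)%N -> c i = c p.-1.
Proof.
move=> pr wp w1 cw; have p1 := prime_gt1 pr; have p0 := prime_gt0 pr.
pose f : {poly rat} := \poly_(i < p.-1) (c i - c p.-1).
pose q : {poly rat} := \poly_(i < p) ('C(p, i.+1)%:R : rat).
have w10 : w - 1 != 0 by rewrite subr_eq0.
have sumw : \sum_(i < p) w ^+ i = 0.
  by apply: (mulfI w10); rewrite -subrX1 wp subrr mulr0.
have fw : (map_poly ratr f).[w] = 0.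
  have -> : map_poly ratr f = \poly_(i < p.-1) (ratr (c i - c p.-1) : C).
    by apply/polyP => i; rewrite coef_map !coef_poly /=; case: ifP => _; rewrite ?raddf0.
  rewrite horner_poly.
  transitivity (\sum_(i < p) (ratr (c i - c p.-1) : C) * w ^+ i).
    by rewrite -[in RHS](prednK p0) big_ord_recr /= subrr rmorph0 mul0r addr0.
  under eq_bigr do rewrite rmorphB mulrBl.
  by rewrite sumrB cw -mulr_sumr sumw mulr0 subrr.
have qw : (map_poly ratr q).[w - 1] = 0.
  apply: (mulfI w10); rewrite mulr0.
  have -> : map_poly ratr q = \poly_(i < p) ('C(p, i.+1)%:R : C).
    by apply/polyP => i; rewrite coef_map !coef_poly /=; case: ifP => _; rewrite ?ratr_nat ?raddf0.
  rewrite horner_poly mulr_sumr.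
  transitivity (w ^+ p - 1); last by rewrite wp subrr.
  have -> : w ^+ p = (1 + (w - 1)) ^+ p by rewrite addrC subrK.
  rewrite exprDn big_ord_recl /= expr1n bin0 expr0 mulr1 addrAC subrr add0r.
  by apply: eq_bigr => i _; rewrite expr1n mul1r mulrCA -exprS mulr_natl.
have sf : (size f < p)%N by rewrite -[leqRHS]prednK // ltnS size_poly.
pose g := f \Po ('X + 1%:P).
have gw : (map_poly ratr g).[w - 1] = 0.
  by rewrite map_comp_poly horner_comp rmorphD /= map_polyX map_polyC /= !hornerE rmorph1 subrK.
have sg : (size g < p)%N by rewrite /g size_comp_poly2 // size_XaddC.
have [g0|g0] := eqVneq g 0.
  have /polyP f0 : f = 0.
    apply/eqP; rewrite -size_poly_eq0 -(@size_comp_poly2 _ f ('X + 1%:P)) ?size_XaddC //.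
    by rewrite -/g g0 size_poly0.
  move=> i ip; have := f0 i; rewrite coef_poly coef0; case: ltnP => [_ /eqP|pi _].
    by rewrite subr_eq0 => /eqP.
  by congr c; apply/eqP; rewrite eqn_leq pi andbT -ltnS prednK.
have sq : size q = p by rewrite size_poly_eq // prednK // binn.
have cop : coprimep (map_poly (ratr : rat -> C) q) (map_poly ratr g).
  rewrite coprimep_map irreducible_poly_coprime; last exact: irreducible_binomial_poly.
  by rewrite gtNdvdp // sq.
by have := coprimep_root cop (introT rootP qw); rewrite gw eqxx.
Qed.

(** * Fourier coefficients of a magic unitary *)

Lemma comm_scaler (C : comNzRingType) (A : algType C) (c : C) (x y : A) :
  GRing.comm x y -> GRing.comm x (c *: y).
Proof. by move=> xy; rewrite /GRing.comm -scalerAl -scalerAr xy. Qed.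

Section Fourier.
Variables (F : finFieldType) (C : fieldType) (A : algType C) (chi : F -> C).
Hypothesis chi0 : chi 0 = 1.
Hypothesis chiD : forall a b, chi (a + b) = chi a * chi b.
Hypothesis chi_sum : forall a, a != 0 -> \sum_x chi (x * a) = 0.
Hypothesis card_neq0 : #|F|%:R != 0 :> C.

Lemma sum_chi a : \sum_x chi (x * a) = if a == 0 then #|F|%:R else 0.
Proof.
case: eqVneq => [->|/chi_sum//].
by under eq_bigr do rewrite mulr0 chi0; rewrite sumr_const.
Qed.

Variable u : F -> F -> A.

(* With u i j = [i is the image of j], this is the i-th entry of the coaction
   applied to the character chi (s * _); [Ucoef s b] is its coefficient on
   chi (b * _). *)
Definition Umode s i := \sum_j chi (s * j) *: u i j.
Definition Ucoef s b := #|F|%:R^-1 *: \sum_i chi (- (b * i)) *: Umode s i.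

Lemma Umode_inv s i : Umode s i = \sum_b chi (b * i) *: Ucoef s b.
Proof.
under eq_bigr => b _.
  rewrite scalerA mulrC -scalerA scaler_sumr.
  under eq_bigr => j _ do rewrite scalerA -chiD -mulrBr.
  over.
rewrite -scaler_sumr exchange_big /= (bigD1 i) //= -scaler_suml sum_chi subrr eqxx.
rewrite big1 ?addr0; last first.
  by move=> j ji; rewrite -scaler_suml sum_chi subr_eq0 eq_sym (negbTE ji) scale0r.
by rewrite scalerA mulVf // scale1r.
Qed.

Lemma u_inv i j : u i j = #|F|%:R^-1 *: \sum_s chi (- (s * j)) *: Umode s i.
Proof.
under eq_bigr => s _.
  rewrite scaler_sumr.
  under eq_bigr => k _ do rewrite scalerA -chiD addrC -mulrBr.
  over.
rewrite exchange_big /= (bigD1 j) //= -scaler_suml sum_chi subrr eqxx.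
rewrite big1 ?addr0; last first.
  by move=> k kj; rewrite -scaler_suml sum_chi subr_eq0 (negbTE kj) scale0r.
by rewrite scalerA mulVf // scale1r.
Qed.

Hypothesis u_row : forall i j k, u i j * u i k = if j == k then u i j else 0.
Hypothesis u_row_sum : forall i, \sum_j u i j = 1.
Hypothesis u_col_sum : forall j, \sum_i u i j = 1.

(** The coaction is multiplicative on characters because distinct entries of a row are
    orthogonal. *)
Lemma Umode_mul s t i : Umode s i * Umode t i = Umode (s + t) i.
Proof.
rewrite mulr_suml; apply: eq_bigr => j _.
rewrite mulr_sumr (bigD1 j) //= big1 ?addr0; last first.
  by move=> k kj; rewrite -scalerAl -scalerAr u_row eq_sym (negbTE kj) !scaler0.
by rewrite -scalerAl -scalerAr u_row eqxx scalerA -chiD -mulrDl.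
Qed.

(** Convolution theorem: summing [chi (b * (j - i))] over [b] forces [i = j], where [Umode_mul]
    applies. *)
Lemma Ucoef_conv s t c : Ucoef (s + t) c = \sum_b Ucoef s b * Ucoef t (c - b).
Proof.
have coef_mul b : Ucoef s b * Ucoef t (c - b) = (#|F|%:R^-1 * #|F|%:R^-1) *:
    \sum_i \sum_j (chi (- (c * j)) * chi (b * (j - i))) *: (Umode s i * Umode t j).
  rewrite -scalerAl -scalerAr scalerA mulr_suml; congr (_ *: _).
  apply: eq_bigr => i _; rewrite mulr_sumr; apply: eq_bigr => j _.
  by rewrite -scalerAl -scalerAr scalerA -!chiD; congr (chi _ *: _); ring.
rewrite (eq_bigr _ (fun b _ => coef_mul b)) -scaler_sumr exchange_big /=.
rewrite -scalerA /Ucoef; congr (_ *: _); rewrite scaler_sumr; apply: eq_bigr => i _.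
rewrite exchange_big /= (bigD1 i) //= -scaler_suml -mulr_sumr sum_chi subrr eqxx.
rewrite big1 ?addr0; last first.
  by move=> j ji; rewrite -scaler_suml -mulr_sumr sum_chi subr_eq0 (negbTE ji) mulr0 scale0r.
by rewrite Umode_mul scalerA [_^-1 * _]mulrC mulfK.
Qed.

(** Row sums make [Umode 0 i] the unit. Being scalars, these coefficients are central, which settles
    the index 0 that [alpha_comm] excludes. *)
Lemma Ucoef0 b : Ucoef 0 b = (#|F|%:R^-1 * \sum_i chi (- (b * i))) *: 1.
Proof.
rewrite -scalerA scaler_suml; congr (_ *: _); apply: eq_bigr => i _; congr (_ *: _).
by rewrite -(u_row_sum i); apply: eq_bigr => j _; rewrite mul0r chi0 scale1r.
Qed.

(** Column sums turn [\sum_i Umode s i] into the scalar [\sum_j chi (s * j)]. This covers [b = 0],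
    which [eigenval_inj] excludes. *)
Lemma Ucoef_trivial s : s != 0 -> Ucoef s 0 = 0.
Proof.
move=> s0; rewrite /Ucoef.
under eq_bigr do rewrite mul0r oppr0 chi0 scale1r.
rewrite exchange_big /=.
under eq_bigr => j _ do rewrite -scaler_sumr u_col_sum mulrC.
by rewrite -scaler_suml chi_sum // scale0r scaler0.
Qed.

Variable S : {set F}.
Hypothesis u_adj : forall i k,
  \sum_j (j - i \in S)%:R * u j k = \sum_j u i j * (k - j \in S)%:R.

Definition eigenval s := \sum_(x in S) chi (s * x).

Lemma sum_translate_eigenval s j : \sum_k (k - j \in S)%:R * chi (s * k) = eigenval s * chi (s * j).
Proof.
rewrite (reindex_inj (addIr j)) /= /eigenval mulr_suml [RHS]big_mkcond /=.
apply: eq_bigr => k _; rewrite addrK mulrDr chiD.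
by case: (k \in S); rewrite ?mul1r ?mul0r.
Qed.

(** Commuting with [u], the adjacency operator acts on [Umode s] by [eigenval s]; in the Fourier
    coefficient at [b] it can be moved onto the character, where it acts by [eigenval b]. *)
Lemma eigenval_Ucoef s b : eigenval s *: Ucoef s b = eigenval b *: Ucoef s b.
Proof.
have actU i : \sum_j (j - i \in S)%:R *: Umode s j = eigenval s *: Umode s i.
  under eq_bigr => j _ do rewrite scaler_sumr.
  rewrite exchange_big /= scaler_sumr.
  transitivity (\sum_k \sum_j (chi (s * k) * (k - j \in S)%:R) *: u i j).
    apply: eq_bigr => k _.
    transitivity (chi (s * k) *: \sum_j (j - i \in S)%:R * u j k).
      rewrite scaler_sumr; apply: eq_bigr => j _; rewrite scalerA mulrC -scalerA.
      by case: (_ \in S); rewrite ?mul1r ?mul0r ?scale1r ?scale0r.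
    rewrite u_adj scaler_sumr; apply: eq_bigr => j _.
    by rewrite -scalerA; case: (_ \in S); rewrite ?mulr1 ?mulr0 ?scale1r ?scale0r.
  rewrite exchange_big /=; apply: eq_bigr => j _; rewrite -scaler_suml scalerA.
  by rewrite -sum_translate_eigenval; under eq_bigr do rewrite mulrC.
rewrite {1}/Ucoef scalerA mulrC -scalerA scaler_sumr.
under eq_bigr => i _ do rewrite scalerA mulrC -scalerA -actU scaler_sumr.
rewrite exchange_big /= /Ucoef [RHS]scalerA [eigenval b * _]mulrC -[RHS]scalerA; congr (_ *: _).
rewrite scaler_sumr; apply: eq_bigr => j _.
under eq_bigr do rewrite scalerA.
rewrite -scaler_suml scalerA; congr (_ *: _).
rewrite (reindex_inj (inj_comp (addrI j) oppr_inj)) /=.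
rewrite /eigenval mulr_suml [RHS]big_mkcond /=.
apply: eq_bigr => k _; rewrite subKr.
case: (k \in S); rewrite ?mulr1 ?mulr0 // -chiD; congr chi; ring.
Qed.

Variable E : {set F}.
Hypothesis eigenval_inj : forall s b, s != 0 -> b != 0 ->
  eigenval s = eigenval b -> b / s \in E.
Hypothesis card_large : (#|E| ^ 4 * 2 + 2 < #|F|)%N.

Lemma u_comm i j k l : GRing.comm (u i j) (u k l).
Proof.
have supp s b : s != 0 -> b / s \notin E -> Ucoef s b = 0.
  move=> s0 bsE; have [->|b0] := eqVneq b 0; first exact: Ucoef_trivial.
  apply/eqP; have /eqP := eigenval_Ucoef s b.
  rewrite -subr_eq0 -scalerBl scaler_eq0 subr_eq0 => /orP[/eqP e|//].
  by case/negP: bsE; apply: eigenval_inj.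
have coefC s b t c : GRing.comm (Ucoef s b) (Ucoef t c).
  have [->|t0] := eqVneq t 0.
    by rewrite Ucoef0; apply: comm_scaler; apply: commr1.
  have [->|s0] := eqVneq s 0.
    by apply: commr_sym; rewrite Ucoef0; apply: comm_scaler; apply: commr1.
  exact: (alpha_comm supp Ucoef_conv card_large).
have modeC s m t n : GRing.comm (Umode s m) (Umode t n).
  rewrite !Umode_inv; apply: commr_sum => c _; apply: comm_scaler; apply: commr_sym.
  by apply: commr_sum => d _; apply: comm_scaler; apply: commr_sym.
rewrite !u_inv; apply: comm_scaler; apply: commr_sum => c _; apply: comm_scaler.
apply: commr_sym; apply: comm_scaler; apply: commr_sum => d _; apply: comm_scaler.
exact: modeC.
Qed.

End Fourier.

(** * Commuting magic unitaries *)

Section CommutingIdempotents.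
Variables (B : pzRingType) (I : eqType) (a : I -> B).
Hypothesis idem : forall i, a i * a i = a i.
Hypothesis aC : forall i j, GRing.comm (a i) (a j).

Lemma mul_prod_idem i (r : seq I) : i \in r ->
  a i * \prod_(j <- r) a j = \prod_(j <- r) a j.
Proof.
elim: r => // j r IHr; rewrite inE big_cons => /orP[/eqP->|ir].
  by rewrite mulrA idem.
by rewrite mulrA aC -mulrA IHr.
Qed.

(** It serves with [r = s], as idempotence of a product; [s] is kept apart so that the induction
    shrinks [r] alone. *)
Lemma prod_idem_sub (r s : seq I) : {subset r <= s} ->
  (\prod_(j <- r) a j) * \prod_(j <- s) a j = \prod_(j <- s) a j.
Proof.
elim: r => [|j r IHr] rs; first by rewrite big_nil mul1r.
rewrite big_cons -mulrA IHr ?mul_prod_idem ?rs ?mem_head // => i ir.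
by rewrite rs // inE ir orbT.
Qed.

Lemma prod_idem_eq0 i j (r : seq I) : i \in r -> j \in r -> a i * a j = 0 ->
  \prod_(k <- r) a k = 0.
Proof.
by move=> ir jr ij0; rewrite -(mul_prod_idem ir) -(mul_prod_idem jr) mulrA ij0 mul0r.
Qed.

End CommutingIdempotents.

Lemma star_sum (R : realType) (A : cstarAlgType R) (I : Type) (r : seq I) (F : I -> A) :
  star (\sum_(i <- r) F i) = \sum_(i <- r) star (F i).
Proof.
apply: (big_morph (@star R A)); first exact: starD.
by rewrite -[X in star X](scale0r 0) starZ rmorph0 scale0r.
Qed.

Lemma star1 (R : realType) (A : cstarAlgType R) : star (1 : A) = 1.
Proof. by rewrite -[LHS]mul1r -{1}[1]starK -starM mul1r starK. Qed.

Lemma star_prod (R : realType) (A : cstarAlgType R) (I : Type) (r : seq I) (a : I -> A) :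
  (forall i j, GRing.comm (a i) (a j)) -> (forall i, star (a i) = a i) ->
  star (\prod_(i <- r) a i) = \prod_(i <- r) a i.
Proof.
move=> aC aS; elim: r => [|i r IHr]; first by rewrite big_nil star1.
by rewrite big_cons starM IHr aS commr_prod.
Qed.

(** * Universal property of C(Aut X) among commuting magic unitaries *)

Section Universal.
Variables (R : realType) (n : nat) (X : sgraph n).

Local Notation G := (subg_of (aut_group X)).
Local Notation CG := (cfunalg R G).

Section Morphism.
Variables (B : cstarAlgType R) (w : 'M[B]_n).
Hypothesis wX : graph_magic X w.
Hypothesis wC : forall i j k l, GRing.comm (w i j) (w k l).

Let wM : magic_unitary w := proj1 wX.

Lemma magic_idem i j : w i j * w i j = w i j.
Proof. by case: (magic_proj wM i j). Qed.

(* The image in B of the indicator function of an automorphism. *)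
Definition autproj (f : 'I_n -> 'I_n) : B := \prod_j w (f j) j.

Lemma mul_autproj f i j : w i j * autproj f = if f j == i then autproj f else 0.
Proof.
have idem := fun j => magic_idem (f j) j.
have comm := fun i j => @wC (f i) i (f j) j.
have absorb := mul_prod_idem idem comm (mem_index_enum j).
case: eqP => [<-//|fji]; rewrite /autproj -absorb mulrA (magic_col_orth wM) ?mul0r //.
by apply/eqP => /esym.
Qed.

(** Two factors annihilate each other: a collision [f i = f j] puts them in one row, and a pair
    whose adjacency [f] changes is handled by the commutation with the adjacency matrix. *)
Lemma autproj_neq_autom (f : 'I_n -> 'I_n) :
  (forall g : G, f =1 autval g -> False) -> autproj f = 0.
Proof.
move=> fP; have idem := fun j => magic_idem (f j) j.
have comm := fun i j => @wC (f i) i (f j) j.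
have orth i j : w (f i) i * w (f j) j = 0 -> autproj f = 0.
  by apply: (prod_idem_eq0 idem comm); exact: mem_index_enum.
have [/injectiveP f_inj|] := boolP (injectiveb f); last first.
  move=> /injectivePn[i [j ij fij]]; apply: (orth i j).
  by rewrite -fij (magic_row_orth wM).
have [/forallP fX|] := boolP [forall i, forall j, X (f i) (f j) == X i j].
  have fG : perm f_inj \in aut_group X
    by rewrite inE; apply/is_automP => i j; rewrite !permE; exact/eqP/(forallP (fX i)).
  by case: (fP (Subg fG)) => j; rewrite /autval /= permE.
rewrite negb_forall => nX; have [i nXi] := existsP nX.
move: nXi; rewrite negb_forall => nXi; have [j Xij] := existsP nXi; apply: (orth i j).
(* Multiplying the entry [(f i, j)] of the commutation relation by [w (f i) i] on the left and
   [w (f j) j] on the right isolates one adjacency bit on each side; these bits differ. *)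
have adjl : (adj_mx B X *m w) (f i) j * w (f j) j = (X (f i) (f j))%:R * w (f j) j.
  rewrite mxE mulr_suml (bigD1 (f j)) //= big1 ?addr0 ?mxE => [|k kfj].
    by rewrite -mulrA magic_idem.
  by rewrite -mulrA (magic_col_orth wM) ?mulr0.
have adjr : w (f i) i * (w *m adj_mx B X) (f i) j = w (f i) i * (X i j)%:R.
  rewrite mxE mulr_sumr (bigD1 i) //= big1 ?addr0 ?mxE => [|k ki].
    by rewrite mulrA magic_idem.
  by rewrite mulrA (magic_row_orth wM) ?mul0r // eq_sym.
have : w (f i) i * (X (f i) (f j))%:R * w (f j) j = w (f i) i * (X i j)%:R * w (f j) j.
  by rewrite -adjr -mulrA -adjl mulrA (proj2 wX).
case: (X (f i) (f j)) (X i j) Xij => [] [] //= _; first by rewrite mulr1 mulr0 mul0r.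
by rewrite mulr0 mul0r mulr1.
Qed.

Lemma sum_autproj : \sum_(g : G) autproj (autval g) = 1.
Proof.
pose h (g : G) : {ffun 'I_n -> 'I_n} := finfun (autval g).
have h_inj : injective h.
  move=> g1 g2 /ffunP g12; apply: val_inj; apply/permP => j.
  by have := g12 j; rewrite !ffunE.
(* The product of all column sums expands into [autproj f] over all functions [f]; only
   automorphisms survive. *)
have <- : \prod_(j < n) \sum_i w i j = 1 by apply: big1 => j _; exact: (magic_col_sum wM).
rewrite bigA_distr_bigA /= (bigID (mem (h @: setT))) /= [X in _ + X]big1 ?addr0.
  rewrite big_imset /=; last by move=> ? ? _ _; exact: h_inj.
  apply: eq_big => [g|g _]; first by rewrite inE.
  by apply: eq_bigr => j _; rewrite ffunE.
move=> f fh; apply: autproj_neq_autom => g fg; case/negP: fh.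
by apply/imsetP; exists g => //; apply/ffunP => j; rewrite ffunE fg.
Qed.

Lemma autproj_mul (g h : G) : autproj (autval g) * autproj (autval h) =
  if g == h then autproj (autval g) else 0.
Proof.
have idem f j := magic_idem (f j : 'I_n) j.
have comm f i j := @wC (f i) i (f j) j.
case: eqP => [<-|gh]; first exact: (prod_idem_sub (idem _) (comm _)).
have [j gj] : exists j, autval g j != autval h j.
  apply/existsP; rewrite -negb_forall; apply/forallP => gEh.
  by apply: gh; apply: val_inj; apply/permP => j; apply/eqP/gEh.
have := mul_autproj (autval g) (autval g j) j; rewrite eqxx => <-.
have gC : GRing.comm (w (autval g j) j) (autproj (autval g)).
  by apply: commr_prod => i _; exact: wC.
by rewrite gC -mulrA mul_autproj eq_sym (negbTE gj) mulr0.
Qed.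

Definition cfun_eval (f : autC R X) : B :=
  \sum_(g : G) (f : CG) g *: autproj (autval g).

Fact cfun_eval_linear : linear cfun_eval.
Proof.
move=> c f1 f2; rewrite /cfun_eval scaler_sumr -big_split; apply: eq_bigr => g _ /=.
by rewrite !ffunE scalerDl scalerA.
Qed.

Fact cfun_eval_multiplicative : monoid_morphism cfun_eval.
Proof.
split=> [|f1 f2]; rewrite /cfun_eval.
  by rewrite -sum_autproj; apply: eq_bigr => g _; rewrite ffunE scale1r.
rewrite mulr_suml; apply: eq_bigr => g _.
rewrite mulr_sumr (bigD1 g) //= big1 ?addr0 => [|h hg].
  by rewrite -scalerAl -scalerAr autproj_mul eqxx ffunE scalerA.
by rewrite -scalerAl -scalerAr autproj_mul eq_sym (negbTE hg) !scaler0.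
Qed.

HB.instance Definition _ :=
  GRing.isLinear.Build R[i] (autC R X) B _ cfun_eval cfun_eval_linear.
HB.instance Definition _ :=
  GRing.isMonoidMorphism.Build (autC R X) B cfun_eval cfun_eval_multiplicative.

Definition cfun_evalm : {lrmorphism autC R X -> B} := cfun_eval.

Lemma cfun_eval_star : star_morphism cfun_evalm.
Proof.
move=> f; rewrite /= /cfun_eval star_sum; apply: eq_bigr => g _.
rewrite starZ star_prod ?ffunE // => i.
by case: (magic_proj wM (autval g i) i).
Qed.

Lemma cfun_eval_magic i j : cfun_evalm (aut_magic R X i j) = w i j.
Proof.
rewrite -[RHS]mulr1 -sum_autproj mulr_sumr; apply: eq_bigr => g _.
by rewrite aut_magicE mul_autproj; case: eqP => _; rewrite ?scale1r ?scale0r.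
Qed.

Lemma cfun_eval_unique (psi : {lrmorphism autC R X -> B}) :
  (forall i j, psi (aut_magic R X i j) = w i j) -> psi =1 cfun_evalm.
Proof.
move=> psiw f.
(* [pr g] is the indicator function of [g], so the entries of [aut_magic] generate the algebra. *)
pose pr (g : G) : autC R X := \prod_j aut_magic R X (autval g j) j.
have -> : f = \sum_(g : G) (f : CG) g *: pr g.
  apply/ffunP => h; rewrite sum_ffunE.
  have prodE g : (pr g : CG) h = (g == h)%:R.
    have -> : (pr g : CG) h = \prod_j (aut_magic R X (autval g j) j : CG) h.
      by apply: (big_morph (fun f : autC R X => (f : CG) h)) => [x y|]; rewrite ffunE.
    case: eqP => [<-|gh]; first by apply: big1 => j _; rewrite aut_magicE eqxx.
    have [j gj] : exists j, autval h j != autval g j.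
      apply/existsP; rewrite -negb_forall; apply/forallP => gEh.
      by apply: gh; apply: val_inj; apply/permP => j; apply/eqP; rewrite eq_sym gEh.
    by rewrite (bigD1 j) //= aut_magicE (negbTE gj) mul0r.
  rewrite (bigD1 h) //= big1 ?addr0 => [|g gh].
    by rewrite ffunE prodE eqxx /GRing.scale /= mulr1.
  by rewrite ffunE prodE (negbTE gh) /GRing.scale /= mulr0.
rewrite !linear_sum; apply: eq_bigr => g _; rewrite !linearZ !rmorph_prod; congr (_ *: _).
by apply: eq_bigr => j _; rewrite [LHS]psiw [RHS]cfun_eval_magic.
Qed.

End Morphism.

Lemma commuting_no_quantum_symmetry :
  (forall (B : cstarAlgType R) (w : 'M[B]_n), graph_magic X w ->
     forall i j k l, GRing.comm (w i j) (w k l)) ->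
  no_quantum_symmetry R X.
Proof.
move=> comm.
have univ : universal_graph_magic X (aut_magic R X).
  split=> [|B w wX]; first exact: aut_magic_graph_magic.
  exists (cfun_evalm wX (comm B w wX)); split.
  - exact: cfun_eval_star.
  - exact: cfun_eval_magic.
  - by move=> psi _; exact: cfun_eval_unique.
split; first by exists (autC R X), (aut_magic R X).
move=> A u [uX uU] phi phiS phiu.
pose theta := cfun_evalm uX (comm A u uX).
have thetaS : star_morphism theta by exact: cfun_eval_star.
have thetau i j : theta (aut_magic R X i j) = u i j by exact: cfun_eval_magic.
(* [chi] and [xi] are the unique star-endomorphisms fixing the generators, so each equals both the
   identity and a composite of [phi] and [theta]. *)
have [chi [_ _ chiU]] := uU A u uX.
have [xi [_ _ xiU]] := univ.2 _ _ univ.1.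
exists theta => x.
  have -> : theta (phi x) = chi x.
    apply: (chiU (theta \o phi)) => [y|i j] /=; first by rewrite phiS thetaS.
    by rewrite phiu thetau.
  by rewrite -(chiU idfun).
have -> : phi (theta x) = xi x.
  apply: (xiU (phi \o theta)) => [y|i j] /=; first by rewrite thetaS phiS.
  by rewrite thetau phiu.
by rewrite -(xiU idfun).
Qed.

End Universal.

(** * Circulant graphs of prime order *)

Section PrimeField.
Variable p : nat.
Hypothesis p_prime : prime p.

(** ['F_p] is an ordinal type whose bound equals [p] only through [Fp_cast]. *)
Lemma sum_Fp_nat (V : nmodType) (f : nat -> V) : \sum_(x : 'F_p) f x = \sum_(i < p) f i.
Proof. by rewrite -(big_mkord xpredT) Fp_cast // big_mkord. Qed.

Variables (C : numClosedFieldType) (w : C).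
Hypotheses (wp : w ^+ p = 1) (w1 : w != 1).

Definition Fp_char (a : 'F_p) : C := w ^+ a.

Lemma Fp_charD a b : Fp_char (a + b) = Fp_char a * Fp_char b.
Proof. by rewrite /Fp_char -exprD /= [X in (_ %% X)%N]Fp_cast // expr_mod. Qed.

Lemma Fp_char_sum a : a != 0 -> \sum_x Fp_char (x * a) = 0.
Proof.
move=> a0; rewrite -(reindex_inj (mulIf a0) (P := xpredT) (F := Fp_char)) /=.
rewrite (sum_Fp_nat (fun i => w ^+ i)).
by apply: (@mulfI _ (w - 1)); rewrite ?subr_eq0 // -subrX1 wp subrr mulr0.
Qed.

(** Both eigenvalues are 0-1 combinations of the powers of [w], so their equality is a rational
    relation and the differences [c i] are constant. As 0 is not in [S], the constant is 0, whence
    sS = bS. *)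
Lemma Fp_eigenval_inj (S : {set 'F_p}) s b : 0 \notin S -> s != 0 -> b != 0 ->
  eigenval Fp_char S s = eigenval Fp_char S b ->
  [set b / s * x | x in S] = S.
Proof.
move=> S0 s0 b0 eig.
pose c i : rat := ((i%:R : 'F_p) / s \in S)%:R - ((i%:R : 'F_p) / b \in S)%:R.
have eigE t : t != 0 ->
    eigenval Fp_char S t = \sum_(i < p) ((i%:R : 'F_p) / t \in S)%:R * w ^+ i.
  move=> t0; rewrite -(sum_Fp_nat (fun i => ((i%:R : 'F_p) / t \in S)%:R * w ^+ i)).
  rewrite (reindex_inj (mulfI t0)) /eigenval big_mkcond; apply: eq_bigr => x _.
  rewrite natr_Zp [t * x]mulrC mulfK //.
  by case: (x \in S); rewrite ?mul1r ?mul0r // /Fp_char mulrC.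
have cw : \sum_(i < p) ratr (c i) * w ^+ i = 0.
  under eq_bigr do rewrite rmorphB mulrBl /= !ratr_nat.
  by rewrite sumrB -!eigE // eig subrr.
have cE := unity_root_relation p_prime wp w1 cw.
have c0 : c 0%N = 0 by rewrite /c !mul0r (negbTE S0) subrr.
have SE y : (y / s \in S) = (y / b \in S).
  have yp : (val y < p)%N by rewrite -[X in (_ < X)%N](Fp_cast p_prime) ltn_ord.
  have := cE _ yp; rewrite -(cE 0%N) ?prime_gt0 // c0 /c natr_Zp => /eqP.
  by rewrite subr_eq0; case: (_ \in S) (_ \in S) => [] [].
apply/eqP; rewrite eqEcard card_imset ?leqnn ?andbT; last first.
  by apply: mulfI; rewrite mulf_neq0 ?invr_eq0.
by apply/subsetP => _ /imsetP[x xS ->]; rewrite mulrAC SE mulrAC mulfV // mul1r.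
Qed.

End PrimeField.

Lemma prime_circulant_comm (R : realType) (p : nat) (X : sgraph p) (l : 'F_p -> 'I_p)
    (S := [set s | X (l 0) (l s)])
    (U := [set a : {unit 'F_p} | [set FinRing.uval a * s | s in S] == S]) :
  prime p -> bijective l ->
  (forall i j t, X (l i) (l j) -> X (l (i + t)) (l (j + t))) ->
  (#|U| ^ 4 * 2 + 2 < p)%N ->
  forall (B : cstarAlgType R) (w : 'M[B]_p), graph_magic X w ->
    forall i j k m, GRing.comm (w i j) (w k m).
Proof.
move=> pr lbij lX Up B w [wM wd].
have [z zp z1] := @nontrivial_unity_root R[i] p pr.
have XS i j : X (l i) (l j) = (j - i \in S).
  rewrite inE; apply/idP/idP => [/(lX _ _ (- i))|/(lX _ _ i)]; first by rewrite subrr.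
  by rewrite add0r subrK.
have S0 : 0 \notin S by rewrite inE adj_irr.
have cardF : #|'F_p| = p by rewrite card_Fp.
pose u i j := w (l i) (l j).
pose E : {set 'F_p} := [set FinRing.uval a | a in U].
have uC : forall i j k m, GRing.comm (u i j) (u k m).
  apply: (@u_comm _ _ _ (@Fp_char p R[i] z) _ _ _ _ u _ _ _ S _ E) => //.
  - exact: Fp_charD.
  - exact: Fp_char_sum.
  - by rewrite cardF Num.Theory.pnatr_eq0 -lt0n prime_gt0.
  - move=> i j k; case: eqP => [->|/eqP jk]; first by case: (magic_proj wM (l i) (l k)).
    by rewrite (magic_row_orth wM) // (inj_eq (bij_inj lbij)).
  - move=> i; rewrite -(magic_row_sum wM (l i)).
    by rewrite [RHS](reindex l) //; exact: onW_bij.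
  - move=> j; rewrite -(magic_col_sum wM (l j)).
    by rewrite [RHS](reindex l) //; exact: onW_bij.
  - move=> i k; have /matrixP/(_ (l i) (l k)) := wd; rewrite !mxE.
    rewrite (reindex l) /=; last exact: onW_bij.
    rewrite [RHS](reindex l) /=; last exact: onW_bij.
    under eq_bigr do rewrite mxE XS.
    by under [RHS]eq_bigr do rewrite mxE XS.

  - move=> s b s0 b0 eig; have bs : b / s \is a GRing.unit.
      by rewrite unitfE mulf_neq0 ?invr_eq0.
    apply/imsetP; exists (FinRing.unit 'F_p bs) => //.
    by rewrite inE /= (Fp_eigenval_inj pr zp z1 S0 s0 b0 eig).
  - rewrite cardF; apply: leq_ltn_trans Up.
    by rewrite leq_add2r leq_mul2r leq_exp2r ?leq_imset_card ?orbT.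
case: lbij => l' lK l'K i j k m.
by have := uC (l' i) (l' j) (l' k) (l' m); rewrite /u !l'K.
Qed.

Theorem theorem5p1 (R : realType) (k : nat) (hk : (0 < k)%N) :
  exists N : nat, forall (p : nat) (X : sgraph p),
    prime p -> (N < p)%N -> circulant_of_type X k -> no_quantum_symmetry R X.
Proof.
(* The bound is the count in [exists_generic]: two families of at most [k ^ 4] values, and two
   single ones. *)
exists (k ^ 4 * 2 + 2)%N => p X pr Np [l [lbij lX] Uk]; apply: commuting_no_quantum_symmetry.
(* ['F_p] unfolds to ['Z_(pdiv p)] while the labels live in ['Z_p]; abstracting the modulus allows
   rewriting [pdiv p] to [p] in all types at once. *)
pose P q := forall l : 'Z_q -> 'I_p, bijective l ->
  (forall i j t, X (l i) (l j) -> X (l (i + t)) (l (j + t))) ->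
  (#|[set a : {unit 'Z_q} | [set (FinRing.uval a * s)%R | s in [set s | X (l 0%R) (l s)]]
        == [set s | X (l 0%R) (l s)]]| ^ 4 * 2 + 2 < p)%N ->
  forall (B : cstarAlgType R) (w : 'M[B]_p), graph_magic X w ->
    forall i j k m, GRing.comm (w i j) (w k m).
have : P (pdiv p) by move=> l'; exact: prime_circulant_comm.
by rewrite (pdiv_id pr) => /(_ l lbij lX); apply; rewrite -Uk in Np.
Qed.
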